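(* Let $\ell\ge1$ be an integer, $\Lambda=\{0,1,\dots,\ell\}$, $\lambda_i=i/\ell$ for $i\in\Lambda$, and $$\mathcal{P}^{\ell}(\pi)=\{\mathrm{P}\in\mathcal{PM}(\mathbb{R}^n):\ \mathrm{P}(\mathcal{C}(\lambda_i))\ge1-\lambda_i\ \ \forall i\in\Lambda\}.$$ Then for every $\pmb{x}\in\mathbb{R}^n$ and $b\in\mathbb{R}$, the constraint $$\sup_{\mathrm{P}\in\mathcal{P}^{\ell}(\pi)}\mathbf{E}_{\mathrm{P}}[\tilde{\pmb{a}}^T\pmb{x}]\le b$$ (where $\tilde{\pmb{a}}$ is distributed according to $\mathrm{P}$) holds if and only if there exist $w\in\mathbb{R}$, $v_i\ge0$, $\gamma_i\ge0$, $\pmb{u}_i\in\mathbb{R}^n$ ($i\in\Lambda$) and $\alpha_{ij},\beta_{ij}\ge0$ ($i\in\Lambda$, $j\in[n]$) such that $$w+\sum_{i\in\Lambda}(\lambda_i-1)v_i\le b,$$ $$\gamma_i\overline\delta(\lambda_i)+\sum_{j\in[n]}\alpha_{ij}(\overline a_j(\lambda_i)-\hat a_j)+\sum_{j\in[n]}\beta_{ij}(\hat a_j-\underline a_j(\lambda_i))+\hat{\pmb{a}}^T\pmb{x}\le w-\sum_{k\le i}v_k\quad (i\in\Lambda),$$ $$\alpha_{ij}-\beta_{ij}+\pmb{B}_j^T\pmb{u}_i=x_j\quad(i\in\Lambda,\ j\in[n]),\qquad \|\pmb{u}_i\|_2\le\gamma_i\quad(i\in\Lambda),$$ where $\pmb{B}_j$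 is the $j$th column of $\pmb{B}$. This is a system of linear and second-order cone constraints.
   Context: Fix $n\ge1$. For each $j\in[n]$ let $\hat a_j\in\mathbb{R}$ and $\underline a_j,\overline a_j>0$, and let $\pi_{\tilde a_j}:\mathbb{R}\to[0,1]$ be continuous with $\pi_{\tilde a_j}(\hat a_j)=1$, $\pi_{\tilde a_j}(t)=0$ for $t\notin(\hat a_j-\underline a_j,\hat a_j+\overline a_j)$, strictly increasing on $[\hat a_j-\underline a_j,\hat a_j]$ and strictly decreasing on $[\hat a_j,\hat a_j+\overline a_j]$. For $\lambda\in(0,1]$ write $\{t:\pi_{\tilde a_j}(t)\ge\lambda\}=[\underline a_j(\lambda),\overline a_j(\lambda)]$, and set $\underline a_j(0)=\hat a_j-\underline a_j$, $\overline a_j(0)=\hat a_j+\overline a_j$. Let $\Gamma>0$ and let $\pi_{\tilde\delta}:[0,\infty)\to[0,1]$ be continuous with $\pi_{\tilde\delta}(0)=1$, strictly decreasing on $[0,\Gamma]$ and $\pi_{\tilde\delta}(t)=0$ for $t\ge\Gamma$; for $\lambda\in(0,1]$ write $\{t\ge0:\pi_{\tilde\delta}(t)\ge\lambda\}=[0,\overline\delta(\lambda)]$ and set $\overline\delta(0)=\Gamma$. Let $\pmb{B}$ be a real $n\times n$ matrix, $\hat{\pmb{a}}=(\hat a_1,\dots,\hat a_n)$, and $\delta(\pmb{a})=\|\pmb{B}(\pmb{a}-\hat{\pmb{a}})\|_2$. The joint possibility distribution is $\pi(\pmb{a})=\min\{\pi_{\tilde a_1}(a_1),\dots,\pi_{\tilde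 a_n}(a_n),\pi_{\tilde\delta}(\delta(\pmb{a}))\}$ for $\pmb{a}\in\mathbb{R}^n$. For $\lambda\in[0,1]$, $\mathcal{C}(\lambda)=\{\pmb{a}\in\mathbb{R}^n:\ a_j\in[\underline a_j(\lambda),\overline a_j(\lambda)]\ \forall j\in[n],\ \|\pmb{B}(\pmb{a}-\hat{\pmb{a}})\|_2\le\overline\delta(\lambda)\}$; for $\lambda\in(0,1]$ this equals $\{\pmb{a}:\pi(\pmb{a})\ge\lambda\}$. $\mathcal{PM}(\mathbb{R}^n)$ is the set of Borel probability measures on $\mathbb{R}^n$. *)

(* Defs.v *)
From HB Require Import structures.
From mathcomp Require Import all_boot all_order all_algebra.
From mathcomp Require Import all_classical all_reals all_analysis.
Set Implicit Arguments. Unset Strict Implicit. Unset Printing Implicit Defensive.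
Import Order.TTheory GRing.Theory Num.Theory.
Local Open Scope classical_set_scope.
Local Open Scope ring_scope.

Definition norm2 (R : realType) (n : nat) (v : 'I_n -> R) : R :=
  Num.sqrt (\sum_(i < n) v i ^+ 2).

Definition Bdiff (R : realType) (n : nat) (B : 'M[R]_n) (ahat : 'I_n -> R)
  (a : n.-tuple R) : 'I_n -> R :=
  fun i => \sum_(j < n) B i j * (tnth a j - ahat j).

(* the set C(lambda); aL j / aU j are the endpoints of the lambda-cuts of
   pi_{a_j}, dbar the right endpoint of the lambda-cut of pi_delta *)
Definition Cset (R : realType) (n : nat) (aL aU : 'I_n -> R -> R)
  (dbar : R -> R) (B : 'M[R]_n) (ahat : 'I_n -> R) (lam : R)
  : set (n.-tuple R) :=
  [set a | (forall j, aL j lam <= tnth a j <= aU j lam) /\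
           norm2 (Bdiff B ahat a) <= dbar lam].

Definition lam (R : realType) (ell : nat) (i : 'I_ell.+1) : R := i%:R / ell%:R.

(* P^ell(pi) : Borel probability measures on R^n (n-tuples with the product
   = Borel sigma-algebra) with P(C(lambda_i)) >= 1 - lambda_i *)
Definition Pell (R : realType) (n ell : nat) (aL aU : 'I_n -> R -> R)
  (dbar : R -> R) (B : 'M[R]_n) (ahat : 'I_n -> R)
  : set (probability (n.-tuple R) R) :=
  [set P | forall i : 'I_ell.+1,
     ((1 - lam R i)%:E <= P (Cset aL aU dbar B ahat (lam R i)))%E].

(* Main.v *)
(* With [h_i] the maximum of [a^T x] over [C(lambda_i)], the supremum over
   [P^ell] is [(h_0 + ... + h_(ell-1)) / ell]: the cuts are nested, so placing
   mass [1/ell] on a maximizer of each cut [i < ell] is feasible, while on [C_0]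
   the function [a^T x] is at most [h_0 - sum_(k >= 1) (h_(k-1) - h_k) 1_(C_k)].
   The dual solution is accordingly [w = h_0], [v_k = h_(k-1) - h_k].

   Each [h_i] equals the value of its conic dual, with both optima attained.  For
   [i < ell] the dual value [D(y)] for the objective [y] is a minimum, since the
   term [dbar ||u||] with [dbar > 0] makes the dual cost coercive.  [D] is
   sublinear, so Hahn-Banach gives a vector [a] with [a.y <= D(y)] for all [y] and
   equality at [y = x]; testing on the vectors [+-e_j] and [B^T u] shows that [a]
   is primal feasible.  For [i = ell] the cut is the single point [ahat]. *)
Require Import Defs.
From HB Require Import structures.
From mathcomp Require Import all_boot all_order all_algebra.
From mathcomp Require Import all_classical all_reals all_analysis.
From mathcomp Require Import measurable_realfun ring lra.
Import Order.TTheory GRing.Theory Num.Theory numFieldNormedType.Exports.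
Local Open Scope classical_set_scope.
Local Open Scope ring_scope.

(** * Sublinear functionals *)

Definition sublinear {R : realType} {V : lmodType R} (p : V -> R) :=
  (forall y z, p (y + z) <= p y + p z) /\
  (forall t y, 0 <= t -> p (t *: y) = t * p y).

Lemma sublinear0 {R : realType} {V : lmodType R} {p : V -> R} :
  sublinear p -> p 0 = 0.
Proof. by case=> _ ph; rewrite -(scale0r 0) ph // mul0r. Qed.

(* Take [q y = inf_(t >= 0) (p (y + t z) - t p z)]. *)
Lemma sublinear_odd_step {R : realType} {V : lmodType R} (p : V -> R) (z : V) :
  sublinear p ->
  exists q : V -> R,
    [/\ sublinear q, (forall y, q y <= p y), q z = p z & q (- z) = - p z].
Proof.
move=> sp; have p0 := sublinear0 sp; have [pD ph] := sp.
pose S y := [set p (y + t *: z) - t * p z | t in [set t : R | 0 <= t]].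
(* Subadditivity bounds the set below, so the infimum is finite. *)
have lbS y : lbound (S y) (- p (- y)).
  move=> _ [t /= t0 <-]; rewrite -ph // lerBrDr addrC lerBlDr.
  by have := pD (y + t *: z) (- y); rewrite addrAC subrr add0r.
have Sn y : S y !=set0 by exists (p (y + 0 *: z) - 0 * p z); exists 0 => //=.
pose q y := inf (S y).
have qle t y : 0 <= t -> q y <= p (y + t *: z) - t * p z.
  move=> t0; apply: ge_inf; first by exists (- p (- y)); exact: lbS.
  by exists t.
have le_q c y : (forall t, 0 <= t -> c <= p (y + t *: z) - t * p z) -> c <= q y.
  by move=> h; apply: lb_le_inf => // _ [t /= t0 <-]; exact: h.
have qlep y : q y <= p y.
  by have := qle 0 y (lexx _); rewrite scale0r addr0 mul0r subr0.
have q0 : q 0 = 0.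
  apply/eqP; rewrite eq_le -{1}p0 qlep /=; apply: (le_q) => t t0.
  by rewrite add0r ph // subrr.
have qD y y' : q (y + y') <= q y + q y'.
  rewrite -lerBlDr; apply: (le_q) => t t0; rewrite lerBlDl -lerBlDr.
  apply: (le_q) => t' t'0.
  have := qle (t + t') (y + y') (addr_ge0 t0 t'0).
  have := pD (y + t *: z) (y' + t' *: z).
  by rewrite scalerDl addrACA; lra.
(* One inequality suffices: applied with [t^-1] to [t *: y] it yields the reverse one. *)
have qh_le t y : 0 < t -> q (t *: y) <= t * q y.
  move=> t0; rewrite -ler_pdivrMl //; apply: (le_q) => s s0.
  rewrite ler_pdivrMl // mulrBr -(ph _ _ (ltW t0)) scalerDr scalerA mulrA.
  by apply: qle; rewrite mulr_ge0 // ltW.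
have sq : sublinear q.
  split=> // t y; rewrite le_eqVlt => /orP[/eqP<-|t0].
    by rewrite scale0r mul0r.
  apply/eqP; rewrite eq_le qh_le //= -ler_pdivlMl //.
  have ti : 0 < t^-1 by rewrite invr_gt0.
  by have := qh_le t^-1 (t *: y) ti; rewrite scalerA mulVf ?gt_eqF // scale1r.
(* The parameter [t = 1] gives [p 0 - p z]. With [q z <= p z] and [0 <= q z + q (- z)], both bounds
   become equalities. *)
have qNz : q (- z) <= - p z.
  by have := qle 1 (- z) ler01; rewrite scale1r addNr p0 mul1r sub0r.
have qz : 0 <= q z + q (- z) by rewrite -q0 -(subrr z) qD.
by have qpz := qlep z; exists q; split=> //; lra.
Qed.

(** From [0 = q 0 <= q z + q (- z) <= p z + p (- z) = 0], equality holds throughout. Thus oddness at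
    a vector, and the value there, survive any later decrease. *)
Lemma sublinear_odd_le {R : realType} {V : lmodType R} (p q : V -> R) (z : V) :
  sublinear q -> (forall y, q y <= p y) -> p (- z) = - p z ->
  q z = p z /\ q (- z) = - q z.
Proof.
move=> sq qp pz; have [qD _] := sq.
have h : 0 <= q z + q (- z) by rewrite -(sublinear0 sq) -(subrr z) qD.
by have := qp z; have := qp (- z); rewrite pz => h1 h2; split; lra.
Qed.

Lemma sublinear_odd_seq {R : realType} {V : lmodType R} (p : V -> R)
    (s : seq V) :
  sublinear p ->
  exists q : V -> R,
    [/\ sublinear q, (forall y, q y <= p y) &
        {in s, forall z, q (- z) = - q z}].
Proof.
move=> sp; elim: s => [|z s [q [sq qp qs]]]; first by exists p; split.
have [r [sr rq rz rNz]] := sublinear_odd_step q z sq.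
exists r; split=> //; first by move=> y; exact: le_trans (rq y) (qp y).
move=> y; rewrite inE => /orP[/eqP->|ys]; first by rewrite rz.
by have [] := sublinear_odd_le q r y sr rq (qs y ys).
Qed.

(** Hahn-Banach in finite dimension: [p] is lowered until it is odd at [x] and at every basis
    vector, at which point it is linear. *)
Lemma sublinear_support {R : realType} {n : nat} (p : 'rV[R]_n -> R)
    (x : 'rV[R]_n) :
  sublinear p ->
  exists a : 'I_n -> R,
    (forall y : 'rV[R]_n, \sum_j a j * y 0 j <= p y) /\ \sum_j a j * x 0 j = p x.
Proof.
(* The vector [x] is treated first, while the value is still [p x]; oddness then freezes that
   value. *)
move=> sp; have [p1 [sp1 p1p p1x p1Nx]] := sublinear_odd_step p x sp.
have [q [sq qp1 qodd]] :=
  sublinear_odd_seq p1 [seq (delta_mx 0 j : 'rV[R]_n) | j <- enum 'I_n] sp1.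
have [qx _] := sublinear_odd_le p1 q x sq qp1 (etrans p1Nx (congr1 -%R (esym p1x))).
have [qD qh] := sq; have q0 := sublinear0 sq.
pose a j := q (delta_mx 0 j).
have qe (c : R) j : q (c *: delta_mx 0 j) = a j * c.
  have [c0|c0] := leP 0 c; first by rewrite qh // mulrC.
  rewrite -[c]opprK scaleNr -scalerN qh ?oppr_ge0 ?ltW // qodd //.
    by rewrite mulrNN opprK mulrC.
  by apply/mapP; exists j; rewrite ?mem_enum.
(* A sublinear functional that is odd on a basis is linear. *)
have qle y : q y <= \sum_j a j * y 0 j.
  rewrite {1}(row_sum_delta y).
  elim/big_ind2 : _ => [|s1 t1 s2 t2 h1 h2|j _]; first by rewrite q0.
  - by apply: le_trans (qD _ _) _; rewrite lerD.
  - by rewrite qe.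
have qE y : q y = \sum_j a j * y 0 j.
  apply/eqP; rewrite eq_le qle /=.
  have := qD y (- y); rewrite subrr q0.
  have := qle (- y).
  have -> : \sum_j a j * (- y) 0 j = - \sum_j a j * y 0 j.
    by rewrite -sumrN; apply: eq_bigr => j _; rewrite mxE mulrN.
  by lra.
exists a; split=> [y|]; rewrite -qE; first exact: le_trans (qp1 y) (p1p y).
by rewrite qx.
Qed.

(** * The Euclidean norm: Cauchy-Schwarz and triangle inequalities *)

Section norm2_theory.
Context {R : realType} {n : nat}.
Implicit Types u v : 'I_n -> R.

Lemma norm2_ge0 u : 0 <= norm2 u.
Proof. exact: sqrtr_ge0. Qed.

Lemma norm2_sqr u : norm2 u ^+ 2 = \sum_(i < n) u i ^+ 2.
Proof. by rewrite sqr_sqrtr // sumr_ge0 // => i _; exact: sqr_ge0. Qed.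

Lemma norm2_le u (c : R) : 0 <= c -> \sum_(i < n) u i ^+ 2 <= c ^+ 2 ->
  norm2 u <= c.
Proof. by move=> c0; rewrite -norm2_sqr ler_pXn2r ?nnegrE ?norm2_ge0. Qed.

Lemma normr_le_norm2 u i : `|u i| <= norm2 u.
Proof.
rewrite -(@ler_pXn2r _ 2) ?nnegrE ?norm2_ge0 // norm2_sqr real_normK ?num_real //.
by rewrite (bigD1 i) //= lerDl sumr_ge0 // => j _; exact: sqr_ge0.
Qed.

Lemma norm2Z (t : R) u : 0 <= t -> norm2 (fun i => t * u i) = t * norm2 u.
Proof.
move=> t0; rewrite /norm2; under eq_bigr do rewrite exprMn.
by rewrite -mulr_sumr sqrtrM ?sqr_ge0 // sqrtr_sqr ger0_norm.
Qed.

(** Weighted AM-GM term by term, with weights [t / s] and [s / t] for the two norms [s], [t], chosen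
    so that the bounds sum to [s * t]. Zero norms are treated apart. *)
Lemma sum_mul_le_norm2 u v : \sum_(i < n) u i * v i <= norm2 u * norm2 v.
Proof.
have [uz|u0] := eqVneq (norm2 u) 0.
  rewrite uz mul0r big1 // => i _; suff -> : u i = 0 by rewrite mul0r.
  by apply/eqP; rewrite -normr_le0 -uz normr_le_norm2.
have [vz|v0] := eqVneq (norm2 v) 0.
  rewrite vz mulr0 big1 // => i _; suff -> : v i = 0 by rewrite mulr0.
  by apply/eqP; rewrite -normr_le0 -vz normr_le_norm2.
have up : 0 < norm2 u by rewrite lt0r u0 norm2_ge0.
have vp : 0 < norm2 v by rewrite lt0r v0 norm2_ge0.
set s := norm2 u; set t := norm2 v.
have h i : u i * v i <= (t / s / 2) * u i ^+ 2 + (s / t / 2) * v i ^+ 2.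
  rewrite -subr_ge0.
  suff -> : (t / s / 2) * u i ^+ 2 + (s / t / 2) * v i ^+ 2 - u i * v i
    = (t * u i - s * v i) ^+ 2 / (2 * (s * t)).
    by rewrite mulr_ge0 ?sqr_ge0 // invr_ge0 !mulr_ge0 // ltW.
  by field; rewrite u0 v0.
apply: le_trans (ler_sum _ (fun i _ => h i)) _.
rewrite big_split /= -!mulr_sumr -!norm2_sqr -/s -/t.
suff -> : t / s / 2 * s ^+ 2 + s / t / 2 * t ^+ 2 = s * t by [].
by field; rewrite u0 v0.
Qed.

Lemma norm2D u v : norm2 (fun i => u i + v i) <= norm2 u + norm2 v.
Proof.
apply: norm2_le; first by rewrite addr_ge0 ?norm2_ge0.
under eq_bigr do rewrite sqrrD -mulr_natr.
rewrite !big_split /= sqrrD !norm2_sqr lerD2r lerD2l -mulr_suml -[leRHS]mulr_natr.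
by rewrite ler_pM2r ?ltr0n // sum_mul_le_norm2.
Qed.

End norm2_theory.

(** * Duality on one cut *)

Section level_duality.
Context {R : realType} {n : nat}.
Variables (up lo : 'I_n -> R) (d : R) (B : 'M[R]_n).
Hypotheses (up0 : forall j, 0 <= up j) (lo0 : forall j, 0 <= lo j) (d0 : 0 < d).

Let d_ge0 : 0 <= d := ltW d0.

(* [up * s^+ + lo * s^-], the support function of [[-lo, up]] *)
Let pen j (s : R) := (up j - lo j) / 2 * s + (up j + lo j) / 2 * `|s|.

Let penD j s t : pen j (s + t) <= pen j s + pen j t.
Proof.
rewrite /pen addrACA -mulrDr lerD2l -mulrDr ler_wpM2l ?ler_normD //.
by rewrite divr_ge0 // addr_ge0.
Qed.

Let penZ j t s : 0 <= t -> pen j (t * s) = t * pen j s.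
Proof. by move=> t0; rewrite /pen normrM (ger0_norm t0); ring. Qed.

Let pen_ge0 j s : 0 <= pen j s.
Proof.
have := ler_norm s; have := ler_norm (- s); rewrite normrN.
by have := up0 j; have := lo0 j; rewrite /pen; nra.
Qed.

(** The dual cost for objective [y] once [u] is fixed: the cheapest [alpha], [beta] are the positive
    and negative parts of [y - u *m B], and [pen] is their price. *)
Let cost (y u : 'rV[R]_n) : R :=
  d * norm2 (u 0) + \sum_j pen j (y 0 j - (u *m B) 0 j).

Let costD (y y' u u' : 'rV[R]_n) : cost (y + y') (u + u') <= cost y u + cost y' u'.
Proof.
rewrite /cost addrACA lerD // -?mulrDr ?ler_wpM2l //.
  have -> : (u + u') 0 = (fun j => u 0 j + u' 0 j) by apply/funext=> j; rewrite mxE.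
  exact: norm2D.
rewrite -big_split ler_sum // => j _ /=.
apply: le_trans (penD _ _ _); rewrite mulmxDl !mxE le_eqVlt; apply/orP; left.
by apply/eqP; congr pen; ring.
Qed.

Let costZ (t : R) (y u : 'rV[R]_n) : 0 <= t -> cost (t *: y) (t *: u) = t * cost y u.
Proof.
move=> t0; rewrite /cost mulrDr mulrCA -(norm2Z t (u 0) t0) mulr_sumr.
rewrite (_ : (t *: u) 0 = fun i => t * u 0 i); last first.
  by apply/funext=> j; rewrite mxE.
by congr (_ + _); apply: eq_bigr => j _; rewrite -penZ // -scalemxAl !mxE mulrBr.
Qed.

Let cost_ge (y u : 'rV[R]_n) : d * norm2 (u 0) <= cost y u.
Proof. by rewrite lerDl sumr_ge0. Qed.

Let continuous_sumf (T : topologicalType) (f : 'I_n -> T -> R) :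
  (forall j, continuous (f j)) -> continuous (fun t => \sum_j f j t).
Proof. by move=> cf; apply: continuous_big => //; exact: add_continuous. Qed.

Let continuous_pen j : continuous (pen j).
Proof.
move=> s; apply: continuousD; apply: continuousM; try exact: cst_continuous.
  exact: cvg_id.
exact: norm_continuous.
Qed.

Let cost_continuous y : continuous (cost y).
Proof.
have cc j : continuous (fun u : 'rV[R]_n => u 0 j) by move=> u; exact: coord_continuous.
have cS : continuous (fun u : 'rV[R]_n => \sum_(j < n) u 0 j ^+ 2).
  by apply: continuous_sumf => j u; exact: (cvgM (cc j u) (cc j u)).
have cN : continuous (fun u : 'rV[R]_n => norm2 (u 0)).
  by move=> u; apply: (continuous_comp (cS u)); exact: sqrt_continuous.
have cB j : continuous (fun u : 'rV[R]_n => y 0 j - (u *m B) 0 j).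
  rewrite (_ : (fun u : 'rV[R]_n => _) = fun u => y 0 j - \sum_k u 0 k * B k j); last first.
    by apply/funext => u; rewrite mxE.
  have cM : continuous (fun u : 'rV[R]_n => \sum_k u 0 k * B k j).
    by apply: continuous_sumf => k u; exact: (cvgM (cc k u) (cvg_cst _)).
  by move=> u; exact: (cvgB (cvg_cst _) (cM u)).
have cP : continuous (fun u : 'rV[R]_n => \sum_j pen j (y 0 j - (u *m B) 0 j)).
  apply: continuous_sumf => j u; apply: (continuous_comp (cB j u)).
  exact: continuous_pen.
by move=> u; exact: (cvgD (cvgM (cvg_cst _) (cN u)) (cP u)).
Qed.

Let cost_min y : exists u, forall u', cost y u <= cost y u'.
Proof.
(* If some entry of [u'] exceeds [M] in absolute value, then [cost y u' >= d * norm2 u' > cost y 0].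
   So a minimum over the compact box is global. *)
pose M := cost y 0 / d.
have M0 : 0 <= M.
  by rewrite divr_ge0 //; apply: le_trans (cost_ge y 0); rewrite mulr_ge0 ?norm2_ge0.
pose A := [set v : 'rV[R]_n | forall i, v ord0 i \in `[- M, M]].
have cA : compact A.
  by apply: (@rV_compact _ _ (fun=> `[- M, M]%classic)) => _; exact: segment_compact.
have A0 : A 0 by move=> i; rewrite mxE in_itv /= oppr_le0 M0.
have [|u _ umin] := @EVT_min_rV R n (cost y) A (ex_intro _ 0 A0) cA.
  by apply: continuous_subspaceT; exact: cost_continuous.
exists u => u'; have [/set_mem Au'|/negP nA] := boolP (u' \in A).
  by apply: umin; rewrite inE.
apply: le_trans (umin 0 _) _; first by rewrite inE.
apply: contrapT => /negP; rewrite -ltNge => lt; apply: nA; rewrite inE => i.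
rewrite in_itv /= -ler_norml; apply: le_trans (normr_le_norm2 (u' ord0) i) _.
by rewrite ler_pdivlMr // mulrC; apply: le_trans (cost_ge y u') (ltW lt).
Qed.

(** Strong duality with both optima attained. Here [a] is a displacement from the centre of the cut,
    so the box is [[-lo, up]]. *)
Lemma level_duality (x : 'I_n -> R) :
  exists (a u alpha beta : 'I_n -> R),
    [/\ forall j, - lo j <= a j <= up j,
        norm2 (fun i => \sum_j B i j * a j) <= d,
        (forall j, 0 <= alpha j) /\ (forall j, 0 <= beta j),
        (forall j, alpha j - beta j + \sum_k B k j * u k = x j) &
        norm2 u * d + \sum_j alpha j * up j + \sum_j beta j * lo j
        = \sum_j a j * x j].
Proof.
have [U minU] := choice cost_min.
pose D y := cost y (U y).
have sD : sublinear D.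
  split=> [y z|t y].
    exact: le_trans (minU _ (U y + U z)) (costD _ _ _ _).
  rewrite le_eqVlt => /orP[/eqP<-|t0].
    rewrite scale0r mul0r; apply/eqP; rewrite eq_le; apply/andP; split.
      by apply: le_trans (minU 0 (0 *: U 0)) _; rewrite -{1}(scale0r 0) costZ // mul0r.
    by apply: le_trans (cost_ge _ _); rewrite mulr_ge0 ?norm2_ge0.
  have hle s z : 0 < s -> D (s *: z) <= s * D z.
    by move=> s0; rewrite /D -(costZ _ _ _ (ltW s0)) minU.
  apply/eqP; rewrite eq_le hle //= -ler_pdivlMl //.
  have ti : 0 < t^-1 by rewrite invr_gt0.
  by have := hle _ (t *: y) ti; rewrite scalerA mulVf ?gt_eqF // scale1r.
pose x' : 'rV[R]_n := \row_j x j.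
have [a [aD ax]] := sublinear_support D x' sD.
have aC (y u : 'rV[R]_n) : \sum_j a j * y 0 j <= cost y u by apply: le_trans (aD y) (minU _ _).
pose u := U x' 0; pose s j := x j - (U x' *m B) 0 j.
have cost0 (y : 'rV[R]_n) : cost y 0 = \sum_j pen j (y 0 j).
  rewrite /cost mul0mx /norm2 big1 ?sqrtr0 ?mulr0 ?add0r.
    by apply: eq_bigr => j _; rewrite mxE subr0.
  by move=> i _; rewrite mxE expr0n.
have sum1 (F : 'I_n -> R) j : (forall i, i != j -> F i = 0) -> \sum_i F i = F j.
  by move=> F0; rewrite (bigD1 j) //= big1 ?addr0.
(* Positive and negative parts of [s]: their difference is [s j] and their price is
   [pen j (s j)]. *)
exists a, u, (fun j => (`|s j| + s j) / 2), (fun j => (`|s j| - s j) / 2); split.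
- move=> j; have pen0 i : pen i 0 = 0 by rewrite /pen normr0 !mulr0 addr0.
  (* Test [y = c e_j] against [u = 0]; the values [c = 1] and [c = -1] give the two box bounds. *)
  have h (c : R) : a j * c <= pen j c.
    have := aC (c *: delta_mx 0 j) 0; rewrite cost0.
    rewrite (sum1 _ j) => [|i ij]; last by rewrite !mxE eqxx (negPf ij) /= !mulr0.
    rewrite (sum1 _ j) => [|i ij]; last by rewrite !mxE eqxx (negPf ij) /= !mulr0 pen0.
    by rewrite !mxE !eqxx mulr1.
  have := h 1; have := h (-1); rewrite /pen normrN normr1 => h1 h2.
  by apply/andP; split; lra.
(* With [b = B a], the test [y = b B], [u = b] makes every penalty vanish and leaves
   [norm2 b ^+ 2 <= d * norm2 b]. *)
- set b := fun i => _.
  pose bv : 'rV[R]_n := \row_i b i.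
  have E : \sum_j a j * (bv *m B) 0 j = norm2 b ^+ 2.
    rewrite norm2_sqr.
    under eq_bigr => j _ do rewrite mxE mulr_sumr.
    rewrite exchange_big; apply: eq_bigr => i _ /=; rewrite expr2 [X in _ = _ * X]/b mulr_sumr.
    by apply: eq_bigr => j _; rewrite mxE; ring.
  have := aC (bv *m B) bv; rewrite E /cost big1 => [|j _]; last first.
    by rewrite subrr /pen normr0 !mulr0 addr0.
  have -> : bv 0 = b by apply/funext=> i; rewrite mxE.
  rewrite addr0 expr2; have [->|N0] := eqVneq (norm2 b) 0; first by [].
  by rewrite ler_pM2r // lt0r N0 norm2_ge0.
- split=> j; rewrite divr_ge0 //; have := ler_norm (s j); have := ler_norm (- s j);
    rewrite normrN; lra.
- move=> j; have -> : \sum_k B k j * u k = (U x' *m B) 0 j.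
    by rewrite mxE; apply: eq_bigr => k _; rewrite mulrC.
  by rewrite /s; field.
- have -> : \sum_j a j * x j = D x' by rewrite -ax; apply: eq_bigr => j _; rewrite mxE.
  rewrite /D /cost mulrC -addrA -big_split; congr (_ + _); apply: eq_bigr => j _ /=.
  by rewrite mxE /pen -/(s j); field.
Qed.

End level_duality.

(** * Measures *)

Section dirac_average.
Context {d : measure_display} {T : measurableType d} {R : realType}.
Variables (m : nat) (a : nat -> T).

(** The uniform distribution on [a 0, ..., a m], repetitions allowed; [m.+1] points keep the total
    mass from being an empty sum. *)
Definition dirac_average : set T -> \bar R :=
  mscale (m.+1%:R^-1)%:nng (msum (fun k => @dirac _ T (a k) R) m.+1).

HB.instance Definition _ := Measure.on dirac_average.

Lemma dirac_averageE (A : set T) :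
  dirac_average A = (m.+1%:R^-1 * \sum_(k < m.+1) \1_A (a k))%:E.
Proof.
rewrite /dirac_average /mscale /msum /= EFinM -sumEFin.
by congr (_ * _)%E; apply: eq_bigr => k _; rewrite diracE indicE.
Qed.

Lemma dirac_average_setT : dirac_average setT = 1%E.
Proof.
rewrite dirac_averageE; under eq_bigr do rewrite indicT /=.
by rewrite sumr_const card_ord mulVf.
Qed.

HB.instance Definition _ :=
  Measure_isProbability.Build _ _ _ dirac_average dirac_average_setT.

Lemma integral_dirac_average (f : T -> R) : measurable_fun setT f ->
  (\int[dirac_average]_x (f x)%:E = (m.+1%:R^-1 * \sum_(k < m.+1) f (a k))%:E)%E.
Proof.
move=> mf.
have ge0 (g : T -> R) : measurable_fun setT g -> (forall x, 0 <= g x) ->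
  (\int[dirac_average]_x (g x)%:E = (m.+1%:R^-1 * \sum_(k < m.+1) g (a k))%:E)%E.
  move=> mg g0; have /measurable_EFinP mG := mg.
  rewrite ge0_integral_mscale //; last by move=> x _; rewrite lee_fin.
  rewrite ge0_integral_measure_sum //; last by move=> x _; rewrite lee_fin.
  rewrite EFinM -sumEFin; congr (_ * _)%E; apply: eq_bigr => k _.
  by rewrite integral_dirac // diracT mul1e.
rewrite integralE.
rewrite -/(EFin \o f) funerpos funerneg.
rewrite !ge0 //; last 2 first.
- exact: measurable_funrneg.
- exact: measurable_funrpos.
rewrite -EFinB -mulrBr -sumrB; congr (_ * _)%:E; apply: eq_bigr => k _.
by rewrite -[in RHS](funrposBneg f).
Qed.

End dirac_average.

(** Integrating the pointwise bound gives [w - sum v_k P(C_k)], and each [P(C_k)] is at least [c_k].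
    The bound holds only on [D], whose complement is null, and [M] ensures integrability there. *)
Lemma integral_le_layers {d : measure_display} {T : measurableType d}
    {R : realType} (P : probability T R) {m : nat} (D : set T)
    (C : 'I_m -> set T) (f : T -> R) (M w : R) (v c : 'I_m -> R) :
  measurable D -> (forall k, measurable (C k)) -> P D = 1%E ->
  measurable_fun setT f -> (forall x, D x -> `|f x| <= M) ->
  (forall x, D x -> f x <= w - \sum_k v k * \1_(C k) x) ->
  (forall k, 0 <= v k) -> (forall k, ((c k)%:E <= P (C k))%E) ->
  (\int[P]_x (f x)%:E <= (w - \sum_k v k * c k)%:E)%E.
Proof.
move=> mD mC PD mf fM fle v0 cP.
have PDc : P (~` D) = 0%E by rewrite probability_setC // PD subee.
have mDc := measurableC mD.
have toD (h : T -> \bar R) : P.-integrable setT h ->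
    (\int[P]_x h x = \int[P]_(x in D) h x)%E.
  by move=> ih; rewrite (negligible_integral mDc) // setTD setCK.
have fi : P.-integrable setT (EFin \o f).
  rewrite (negligible_integrable mDc) //; last exact/measurable_EFinP.
  rewrite setTD setCK; apply: measurable_bounded_integrable => //.
  - by apply: le_lt_trans (probability_le1 P mD) (ltry 1).
  - exact: measurable_funTS.
  - by exists M; split; [exact: num_real|move=> y My x Dx; exact: le_trans (fM x Dx) (ltW My)].
have wi : P.-integrable setT (fun=> w%:E) by apply: finite_measure_integrable_cst.
have ci k : P.-integrable setT (fun x => (v k)%:E * (\1_(C k) x)%:E)%E.
  by apply: integrableZl => //; exact: integrable_indic.
have si : P.-integrable setT (fun x => \sum_k (v k)%:E * (\1_(C k) x)%:E)%E.
  by apply: integrable_sum => // k _; exact: ci.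
have gi : P.-integrable setT (fun x => w%:E - \sum_k (v k)%:E * (\1_(C k) x)%:E)%E.
  exact: integrableB.
apply: (@le_trans _ _ (\int[P]_x (w%:E - \sum_k (v k)%:E * (\1_(C k) x)%:E))%E).
  rewrite (toD _ fi) (toD _ gi); apply: le_integral => //.
  - exact: (integrableS measurableT).
  - exact: (integrableS measurableT).
  - move=> x /set_mem Dx; under eq_bigr do rewrite -EFinM.
    by rewrite sumEFin -EFinB lee_fin fle.
have wE : (\int[P]_x w%:E = w%:E)%E.
  by rewrite integral_cst // [X in (_ * X)%E](_ : _ = 1%E) ?mule1 //; exact: probability_setT.
rewrite integralB // wE integral_sum //.
rewrite EFinB leeB // -sumEFin lee_sum // => k _.
rewrite integralZl //; last exact: integrable_indic.
by rewrite integral_indic // setIT EFinM lee_wpmul2l ?lee_fin.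
Qed.

(** * Nested cuts *)

(** Substituting for [x] splits [a.x] into [u.(B a)], bounded by Cauchy-Schwarz, and
    [sum (alpha - beta) a], bounded by the box. *)
Lemma level_weak_duality {R : realType} {n : nat} (up lo : 'I_n -> R) (d : R)
    (B : 'M[R]_n) (x a u alpha beta : 'I_n -> R) (gam : R) :
  (forall j, - lo j <= a j <= up j) ->
  norm2 (fun i => \sum_j B i j * a j) <= d ->
  (forall j, 0 <= alpha j) -> (forall j, 0 <= beta j) ->
  (forall j, alpha j - beta j + \sum_k B k j * u k = x j) ->
  norm2 u <= gam ->
  \sum_j a j * x j <= gam * d + \sum_j alpha j * up j + \sum_j beta j * lo j.
Proof.
move=> ab nd al0 be0 xE ug.
have -> : \sum_j a j * x j = \sum_k u k * (\sum_j B k j * a j)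
    + \sum_j (alpha j * a j + beta j * - a j).
  under [X in _ = X + _]eq_bigr do rewrite mulr_sumr.
  rewrite exchange_big -big_split; apply: eq_bigr => j _ /=.
  rewrite -xE mulrDr mulr_sumr addrC.
  by congr (_ + _); [|apply: eq_bigr => k _]; ring.
rewrite -addrA lerD //.
  apply: le_trans (sum_mul_le_norm2 _ _) _.
  by rewrite ler_pM // norm2_ge0.
rewrite -big_split ler_sum // => j _ /=; have /andP[h1 h2] := ab j.
by rewrite lerD // ler_wpM2l // lerNl.
Qed.

(** Recentring at [ahat] puts the cut in the form used by the duality lemmas. *)
Lemma CsetP {R : realType} {n : nat} (aL aU : 'I_n -> R -> R) (dbar : R -> R)
    (B : 'M[R]_n) (ahat : 'I_n -> R) (lm : R) (a : n.-tuple R) :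
  Cset aL aU dbar B ahat lm a <->
  (forall j, - (ahat j - aL j lm) <= tnth a j - ahat j <= aU j lm - ahat j) /\
  norm2 (fun i => \sum_j B i j * (tnth a j - ahat j)) <= dbar lm.
Proof.
by split=> -[h1 h2]; split=> // j; have /andP[l1 l2] := h1 j; apply/andP; split; lra.
Qed.

Lemma measurable_Cset {R : realType} {n : nat} (aL aU : 'I_n -> R -> R)
    (dbar : R -> R) (B : 'M[R]_n) (ahat : 'I_n -> R) (lm : R) :
  measurable (Cset aL aU dbar B ahat lm).
Proof.
have mt j : measurable_fun [set: n.-tuple R] (fun a => tnth a j : R) by exact: measurable_tnth.
have mle (f g : n.-tuple R -> R) : measurable_fun setT f -> measurable_fun setT g ->
    measurable [set a | f a <= g a].
  by move=> mf mg; rewrite -[X in measurable X]setTI; exact: measurable_fun_le.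
have -> : Cset aL aU dbar B ahat lm =
    (\bigcap_(j in [set: 'I_n]) ([set a | aL j lm <= tnth a j] `&` [set a | tnth a j <= aU j lm]))
    `&` [set a | norm2 (Bdiff B ahat a) <= dbar lm].
  apply/seteqP; split=> a /= [h1 h2]; split=> // j; first by move=> _; apply/andP.
  by apply/andP; exact: h1.
apply: measurableI.
  apply: fin_bigcap_measurable; first exact: finite_finset.
  by move=> j _; apply: measurableI; apply: mle => //; exact: measurable_cst.
apply: mle; last exact: measurable_cst.
have mS : measurable_fun setT (fun a : n.-tuple R => \sum_(i < n) Bdiff B ahat a i ^+ 2).
  apply: measurable_sum => i; apply: measurable_funX; apply: measurable_sum => j.
  by apply: measurable_funM => //; apply: measurable_funB.
have msqrt : measurable_fun setT (@Num.sqrt R).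
  by apply: continuous_measurable_fun; exact: sqrt_continuous.
exact: (measurableT_comp msqrt mS).
Qed.

Lemma level_optimum {R : realType} {n : nat} (aL aU : 'I_n -> R -> R)
    (dbar : R -> R) (B : 'M[R]_n) (ahat x : 'I_n -> R) (lm : R) :
  (forall j, aL j lm <= ahat j <= aU j lm) ->
  0 < dbar lm \/ (dbar lm = 0 /\ forall j, aL j lm = ahat j /\ aU j lm = ahat j) ->
  exists (a : n.-tuple R) (u alpha beta : 'I_n -> R),
    [/\ Cset aL aU dbar B ahat lm a,
        (forall j, 0 <= alpha j) /\ (forall j, 0 <= beta j),
        (forall j, alpha j - beta j + \sum_k B k j * u k = x j) &
        norm2 u * dbar lm + \sum_j alpha j * (aU j lm - ahat j)
          + \sum_j beta j * (ahat j - aL j lm) + \sum_j ahat j * x j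
        = \sum_j tnth a j * x j].
Proof.
move=> aLU [d0|[dz az]].
  have [j||a [u [al [be [ab nd [al0 be0] xE val]]]]] := @level_duality R n
    (fun j => aU j lm - ahat j) (fun j => ahat j - aL j lm) (dbar lm) B _ _ d0 x.
  - by have /andP[] := aLU j; rewrite subr_ge0.
  - by move=> j; have /andP[] := aLU j; rewrite subr_ge0.
  have aE j : tnth [tuple ahat j + a j | j < n] j - ahat j = a j.
    by rewrite tnth_mktuple addrC addKr.
  exists [tuple ahat j + a j | j < n], u, al, be; split=> //.
    apply/CsetP; split=> [j|]; first by rewrite aE.
    by under eq_fun do under eq_bigr do rewrite aE.
  rewrite val -big_split; apply: eq_bigr => j _ /=.
  by rewrite tnth_mktuple; ring.
(* Degenerate cut: [u = 0] with the positive and negative parts of [x]. All widths and [dbar lm] are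
   zero, so both values equal [ahat.x]. *)
exists [tuple ahat j | j < n], (fun=> 0), (fun j => (`|x j| + x j) / 2),
  (fun j => (`|x j| - x j) / 2).
split.
- apply/CsetP; split=> [j|].
    by rewrite tnth_mktuple; have [-> ->] := az j; rewrite subrr oppr0 lexx.
  rewrite dz /norm2 big1 ?sqrtr0 // => i _; rewrite big1 ?expr0n // => j _.
  by rewrite tnth_mktuple subrr mulr0.
- split=> j; rewrite divr_ge0 //; have := ler_norm (x j); have := ler_norm (- x j);
    rewrite normrN; lra.
- by move=> j; rewrite big1 => [|k _]; rewrite ?mulr0 //; field.
- rewrite dz mulr0 add0r big1 => [|j _]; last by have [_ ->] := az j; rewrite subrr mulr0.
  rewrite big1 => [|j _]; last by have [-> _] := az j; rewrite subrr mulr0.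
  by rewrite !add0r; apply: eq_bigr => j _; rewrite tnth_mktuple.
Qed.

(** Counts the indices from [i] to [m - 1]; truncated subtraction covers [i > m]. *)
Lemma sum_geq {R : pzSemiRingType} (i m : nat) :
  \sum_(k < m) (i <= k)%N%:R = (m - i)%:R :> R.
Proof.
elim: m => [|m IH]; first by rewrite big_ord0.
rewrite big_ord_recr /= IH -natrD; congr (_%:R).
by case: leqP => h; [rewrite subSn // addn1|rewrite addn0 (eqP (ltnW h)); exact/esym/eqP].
Qed.

(** Telescoping; the term [k = 0] is zero because [0.-1 = 0]. *)
Lemma sum_decrements {R : pzRingType} (H : nat -> R) (m : nat) :
  \sum_(k < m.+1) (H k.-1 - H k) = H 0%N - H m.
Proof.
elim: m => [|m IH]; first by rewrite big_ord1.
by rewrite big_ord_recr /= IH addrA subrK.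
Qed.

(** Summation by parts. For [L = m] the term in [H m] drops out, which is how the last cut
    disappears from the dual objective. *)
Lemma sum_weighted_decrements {R : comPzRingType} (H : nat -> R) (L : R) (m : nat) :
  \sum_(k < m.+1) (k%:R - L) * (H k.-1 - H k)
  = \sum_(k < m) H k + (L - m%:R) * H m - L * H 0%N.
Proof.
elim: m => [|m IH].
  by rewrite big_ord1 big_ord0 /= subrr mulr0 add0r subr0 subrr.
rewrite big_ord_recr /= IH [in RHS]big_ord_recr /= -natr1.
by ring.
Qed.

(** * Cuts of the possibility distributions *)

Section nested_cuts.
Context {R : realType} {n : nat}.
Variables (ahat alo ahi : 'I_n -> R) (pia : 'I_n -> R -> R).
Variables (aL aU : 'I_n -> R -> R) (Gamma : R) (pid dbar : R -> R) (B : 'M[R]_n).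
Hypotheses (alo0 : forall j, 0 < alo j) (ahi0 : forall j, 0 < ahi j)
  (pia_hat : forall j, pia j (ahat j) = 1)
  (pia_out : forall j t, t <= ahat j - alo j \/ ahat j + ahi j <= t -> pia j t = 0)
  (pia_inc : forall j s t, ahat j - alo j <= s -> s < t -> t <= ahat j ->
     pia j s < pia j t)
  (pia_dec : forall j s t, ahat j <= s -> s < t -> t <= ahat j + ahi j ->
     pia j t < pia j s)
  (pia_cut : forall j lm, 0 < lm <= 1 -> forall t,
     lm <= pia j t <-> aL j lm <= t <= aU j lm)
  (aL0 : forall j, aL j 0 = ahat j - alo j)
  (aU0 : forall j, aU j 0 = ahat j + ahi j)
  (Gamma0 : 0 < Gamma)
  (pid_cont : {within [set t : R | 0 <= t], continuous pid})
  (pid0 : pid 0 = 1)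
  (pid_dec : forall s t, 0 <= s -> s < t -> t <= Gamma -> pid t < pid s)
  (pid_out : forall t, Gamma <= t -> pid t = 0)
  (pid_cut : forall lm, 0 < lm <= 1 -> forall t, 0 <= t ->
     (lm <= pid t <-> t <= dbar lm))
  (dbar0 : dbar 0 = Gamma).

Lemma cut_center (lm : R) j : 0 <= lm <= 1 -> aL j lm <= ahat j <= aU j lm.
Proof.
move=> /andP[]; rewrite le_eqVlt => /orP[/eqP<- _|l0 l1].
  by rewrite aL0 aU0; have := alo0 j; have := ahi0 j => h1 h2; apply/andP; split; lra.
by apply/pia_cut; rewrite ?l0 ?l1 // pia_hat.
Qed.

Lemma pia_lt1 j t : t != ahat j -> pia j t < 1.
Proof.
rewrite neq_lt => /orP[lt|gt].
  have [t_out|t_in] := leP t (ahat j - alo j); first by rewrite pia_out ?ltr01 //; left.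
  by rewrite -(pia_hat j); apply: pia_inc => //; exact: ltW.
have [t_out|t_in] := leP (ahat j + ahi j) t; first by rewrite pia_out ?ltr01 //; right.
by rewrite -(pia_hat j); apply: pia_dec => //; exact: ltW.
Qed.

(** The cut at level 1 contains its own endpoints, since it contains [ahat j]; but [pia j] is below
    1 everywhere else. *)
Lemma cut1 j : aL j 1 = ahat j /\ aU j 1 = ahat j.
Proof.
have o1 : 0 < (1 : R) <= 1 by rewrite ltr01 lexx.
have /andP[cL cU] : aL j 1 <= ahat j <= aU j 1 by apply: cut_center; rewrite ler01 lexx.
have LU := le_trans cL cU.
split; apply/eqP; apply: contrapT => /negP /pia_lt1; rewrite ltNge => /negP; apply;
  by apply/(pia_cut j 1 o1); rewrite lexx LU.
Qed.

(** By continuity at 0, [pid] still exceeds [lm < 1] at some positive [e / 2], which therefore lies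
    in the cut. *)
Lemma dbar_gt0 (lm : R) : 0 <= lm < 1 -> 0 < dbar lm.
Proof.
move=> /andP[]; rewrite le_eqVlt => /orP[/eqP<- _|l0 l1]; first by rewrite dbar0.
have pid_cvg : pid t @[t --> within [set t : R | 0 <= t] (nbhs (0 : R))] --> (1 : R).
  by rewrite -pid0; move/subspace_continuousP : pid_cont => /(_ 0 (lexx 0)).
have /nbhs_ballP[e /= e0 he] : nbhs (0 : R) [set t | 0 <= t -> lm < pid t].
  exact: (cvgr_gt _ pid_cvg _ l1).
have e20 : 0 < e / 2 by rewrite divr_gt0.
have : lm < pid (e / 2).
  apply: he; rewrite /= ?(ltW e20) // /ball /= sub0r normrN gtr0_norm //.
  by rewrite ltr_pdivrMr // ltr_pMr // ltr1n.
move=> /ltW /(pid_cut lm _ _ (ltW e20)); rewrite l0 (ltW l1) => /(_ isT).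
exact: lt_le_trans.
Qed.

Lemma dbar1 : dbar 1 = 0.
Proof.
have o1 : 0 < (1 : R) <= 1 by rewrite ltr01 lexx.
apply/eqP; rewrite eq_le; apply/andP; split; last first.
  by apply/(pid_cut 1 o1 0 (lexx 0)); rewrite pid0.
rewrite leNgt; apply/negP => d0.
(* The minimum stays in the cut and within [[0, Gamma]], where strict decrease gives [pid t < 1]. *)
pose t := Num.min (dbar 1) Gamma.
have t0 : 0 < t by rewrite lt_min d0 Gamma0.
have : 1 <= pid t by apply/(pid_cut 1 o1 t (ltW t0)); rewrite ge_min lexx.
by rewrite -pid0 leNgt pid_dec // ge_min lexx orbT.
Qed.

(** For [l > 0] a larger threshold gives a smaller superlevel set. Level 0 is set by convention, so
    there the vanishing of [pia] and [pid] outside their supports is used instead. *)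
Lemma Cset_antitone (l m : R) : 0 <= l -> l <= m -> m <= 1 ->
  Cset aL aU dbar B ahat m `<=` Cset aL aU dbar B ahat l.
Proof.
move=> l0; rewrite le_eqVlt => /orP[/eqP-> _ //|lm] m1 a [aC dC].
have mo : 0 < m <= 1 by rewrite (le_lt_trans l0 lm) m1.
have m0 : 0 < m by case/andP: mo.
have N0 := norm2_ge0 (Bdiff B ahat a).
split=> [j|].
  have mp := (pia_cut j m mo (tnth a j)).2 (aC j).
  move: l0 lm; rewrite le_eqVlt => /orP[/eqP<- _|l0 lm].
    rewrite aL0 aU0; apply/andP; split; rewrite leNgt; apply/negP => /ltW h.
      by move: mp; rewrite (pia_out _ _ (or_introl h)) leNgt m0.
    by move: mp; rewrite (pia_out _ _ (or_intror h)) leNgt m0.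
  by apply/(pia_cut j l); rewrite ?l0 ?(le_trans (ltW lm)).
have mp := (pid_cut m mo _ N0).2 dC.
move: l0 lm; rewrite le_eqVlt => /orP[/eqP<- _|l0 lm].
  rewrite dbar0 leNgt; apply/negP => /ltW h.
  by move: mp; rewrite pid_out // leNgt m0.
by apply/(pid_cut l); rewrite ?l0 ?(le_trans (ltW lm)).
Qed.

Lemma level_solution (x : 'I_n -> R) (lm : R) : 0 <= lm <= 1 ->
  exists (a : n.-tuple R) (u alpha beta : 'I_n -> R),
    [/\ Cset aL aU dbar B ahat lm a,
        (forall j, 0 <= alpha j) /\ (forall j, 0 <= beta j),
        (forall j, alpha j - beta j + \sum_k B k j * u k = x j) &
        norm2 u * dbar lm + \sum_j alpha j * (aU j lm - ahat j)
          + \sum_j beta j * (ahat j - aL j lm) + \sum_j ahat j * x j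
        = \sum_j tnth a j * x j].
Proof.
move=> lm01; apply: level_optimum; first by move=> j; exact: cut_center.
have /andP[l0] := lm01; rewrite le_eqVlt => /orP[/eqP->|l1].
  by right; split; [exact: dbar1|exact: cut1].
by left; apply: dbar_gt0; rewrite l0.
Qed.

End nested_cuts.

(** * Equivalence of the distributionally robust constraint and the conic system *)

Theorem theorem2 (R : realType) (n ell : nat)
  (ahat alo ahi : 'I_n -> R) (pia : 'I_n -> R -> R) (aL aU : 'I_n -> R -> R)
  (Gamma : R) (pid : R -> R) (dbar : R -> R) (B : 'M[R]_n) :
  (1 <= n)%N -> (1 <= ell)%N ->
  (* possibility distributions of the a_j *)
  (forall j, 0 < alo j) -> (forall j, 0 < ahi j) ->
  (forall j, continuous (pia j)) ->
  (forall j t, 0 <= pia j t <= 1) ->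
  (forall j, pia j (ahat j) = 1) ->
  (forall j t, t <= ahat j - alo j \/ ahat j + ahi j <= t -> pia j t = 0) ->
  (forall j s t, ahat j - alo j <= s -> s < t -> t <= ahat j ->
     pia j s < pia j t) ->
  (forall j s t, ahat j <= s -> s < t -> t <= ahat j + ahi j ->
     pia j t < pia j s) ->
  (forall j lm, 0 < lm <= 1 -> forall t,
     lm <= pia j t <-> aL j lm <= t <= aU j lm) ->
  (forall j, aL j 0 = ahat j - alo j) ->
  (forall j, aU j 0 = ahat j + ahi j) ->
  (* possibility distribution of delta *)
  0 < Gamma ->
  {within [set t : R | 0 <= t], continuous pid} ->
  (forall t, 0 <= t -> 0 <= pid t <= 1) ->
  pid 0 = 1 ->
  (forall s t, 0 <= s -> s < t -> t <= Gamma -> pid t < pid s) ->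
  (forall t, Gamma <= t -> pid t = 0) ->
  (forall lm, 0 < lm <= 1 -> forall t, 0 <= t ->
     (lm <= pid t <-> t <= dbar lm)) ->
  dbar 0 = Gamma ->
  forall (x : 'I_n -> R) (b : R),
    (ereal_sup ((fun P : probability (n.-tuple R) R =>
                   \int[P]_a (\sum_(j < n) tnth a j * x j)%:E)
                 @` Pell ell aL aU dbar B ahat) <= b%:E)%E
    <->
    exists (w : R) (v gam : 'I_ell.+1 -> R) (u : 'I_ell.+1 -> 'I_n -> R)
           (alpha beta : 'I_ell.+1 -> 'I_n -> R),
      (forall i, 0 <= v i) /\ (forall i, 0 <= gam i) /\
          (forall i j, 0 <= alpha i j) /\ (forall i j, 0 <= beta i j) /\
          w + \sum_(i < ell.+1) (lam R i - 1) * v i <= b /\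
          (forall i : 'I_ell.+1,
             gam i * dbar (lam R i)
             + \sum_(j < n) alpha i j * (aU j (lam R i) - ahat j)
             + \sum_(j < n) beta i j * (ahat j - aL j (lam R i))
             + \sum_(j < n) ahat j * x j
             <= w - \sum_(k < ell.+1 | (k <= i)%N) v k) /\
          (forall i j, alpha i j - beta i j + \sum_(k < n) B k j * u i k = x j) /\
          (forall i, norm2 (u i) <= gam i).

Proof.
move=> n1 ell1 alo0 ahi0 _ _ pia_hat pia_out pia_inc pia_dec pia_cut aL0 aU0
  Gamma0 pid_cont _ pid0 pid_dec pid_out pid_cut dbar0 x b.
pose C (i : 'I_ell.+1) := Cset aL aU dbar B ahat (lam R i).
pose f (a : n.-tuple R) := \sum_(j < n) tnth a j * x j.
have ellR : 0 < ell%:R :> R by rewrite ltr0n.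
have lam01 (i : 'I_ell.+1) : 0 <= lam R i <= 1.
  by rewrite /lam divr_ge0 //= ler_pdivrMr // mul1r ler_nat -ltnS ltn_ord.
have CS (i k : 'I_ell.+1) : (i <= k)%N -> C k `<=` C i.
  move=> ik; have /andP[l0 _] := lam01 i; have /andP[_ l1] := lam01 k.
  by apply: (Cset_antitone _ _ _ _ _ _ _ _ _ _ pia_out pia_cut aL0 aU0 pid_out pid_cut dbar0) => //;
    rewrite /lam ler_pM2r ?invr_gt0 // ler_nat.
have mC i : measurable (C i) by exact: measurable_Cset.
have mf : measurable_fun setT f.
  apply: measurable_sum => j; apply: measurable_funM; last exact: measurable_cst.
  exact: measurable_tnth.
(* Weak duality on the cut [C i]; it serves both directions, the second one for the sign of [v]. *)
have weak (i : 'I_ell.+1) u al be gam a : (forall j, 0 <= al j) -> (forall j, 0 <= be j) ->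
    (forall j, al j - be j + \sum_(k < n) B k j * u k = x j) -> norm2 u <= gam -> C i a ->
    f a <= gam * dbar (lam R i) + \sum_(j < n) al j * (aU j (lam R i) - ahat j)
      + \sum_(j < n) be j * (ahat j - aL j (lam R i)) + \sum_(j < n) ahat j * x j.
  move=> al0 be0 xE ug /CsetP[ab nd].
  have := level_weak_duality _ _ _ _ _ _ _ _ _ _ ab nd al0 be0 xE ug.
  suff -> : f a = \sum_j (tnth a j - ahat j) * x j + \sum_j ahat j * x j by rewrite lerD2r.
  by rewrite -big_split; apply: eq_bigr => j _ /=; ring.
split; last first.
  move=> [w [v [gam [u [al [be [v0 [gam0 [al0 [be0 [wb [lev [xE ug]]]]]]]]]]]]].
  apply: ge_ereal_sup => _ [P PC <-].
  pose M := \sum_(j < n) (`|aL j (lam R (ord0 : 'I_ell.+1))| + `|aU j (lam R (ord0 : 'I_ell.+1))|) * `|x j|.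
  (* Since [lambda_0 = 0], the level 0 constraint forces full mass on [C ord0]. *)
  have PC0 : P (C ord0) = 1%E.
    apply/eqP; rewrite eq_le probability_le1 //=.
    by apply: le_trans (PC ord0); rewrite lee_fin /lam /= mul0r subr0.
  apply: le_trans (integral_le_layers P (C ord0) C f M w v (fun i => 1 - lam R i)
    (mC _) mC PC0 mf _ _ v0 PC) _.
  - move=> a [aC _]; apply: le_trans (ler_norm_sum _ _ _) _; apply: ler_sum => j _.
    rewrite normrM ler_wpM2r //; have /andP[h1 h2] := aC j.
    rewrite ler_norml; have := ler_norm (aU j (lam R (ord0 : 'I_ell.+1))).
    have := ler_norm (- aL j (lam R (ord0 : 'I_ell.+1))); rewrite normrN => h3 h4.
    have := normr_ge0 (aU j (lam R (ord0 : 'I_ell.+1))).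
    have := normr_ge0 (aL j (lam R (ord0 : 'I_ell.+1))) => h5 h6.
    by apply/andP; split; lra.
  - move=> a aC0.
    (* Take the deepest cut containing [a]. By nesting [a] lies in [C k] exactly for [k <= i], so
       the indicator sum is the partial sum of [v] in the constraint of level [i]. *)
    have [i /asboolP iC imax] := @arg_maxnP _ ord0 (fun i => `[< C i a >]) (fun i => nat_of_ord i)
      (asboolT aC0).
    apply: le_trans (weak i _ _ _ _ _ (al0 i) (be0 i) (xE i) (ug i) iC) _.
    apply: le_trans (lev i) _.
    rewrite le_eqVlt; apply/orP; left; apply/eqP; congr (_ - _).
    rewrite [LHS]big_mkcond; apply: eq_bigr => k _; rewrite indicE.
    case: leqP => ik.
      by rewrite mem_set ?mulr1 //; exact: CS ik _ iC.
    rewrite memNset ?mulr0 // => kC.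
    by have := imax k (asboolT kC); rewrite /= leqNgt ik.
  rewrite lee_fin; apply: le_trans wb; rewrite lerD2l -sumrN.
  by apply: ler_sum => i _; rewrite -mulrN opprB mulrC.
(* Writing [ell = m.+1] makes [dirac_average m] an average of exactly [ell] points. *)
case: ell ell1 @C ellR lam01 CS mC weak => [//|m] _ C ellR lam01 CS mC weak supb.
have sol (i : 'I_m.+2) := level_solution ahat alo ahi pia aL aU Gamma pid dbar B alo0 ahi0 pia_hat pia_out
  pia_inc pia_dec pia_cut aL0 aU0 Gamma0 pid_cont pid0 pid_dec pid_cut dbar0 x (lam R i) (lam01 i).
have [A /choice[u /choice[al /choice[be solE]]]] := choice sol.
have AC i : C i (A i) by have [] := solE i.
(* The optimal values [h_k], indexed by naturals so that [k.-1] and the summation lemmas apply. *)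
pose H (k : nat) := f (A (inord k)).
have HE (i : 'I_m.+2) : H i = f (A i) by rewrite /H inord_val.
have ordW (k : nat) (i : 'I_m.+2) : (k <= i)%N -> (inord k : 'I_m.+2) = k :> nat.
  by move=> ki; rewrite inordK // (leq_ltn_trans ki).
(* Here [v_0 = 0], because [0.-1 = 0]. *)
exists (H 0%N), (fun i => H i.-1 - H i), (fun i => norm2 (u i)), u, al, be.
split; last split; last split; last split; last split; last split; last split.
(* The maximizer [A i] also lies in the preceding, larger cut, whose dual value bounds it. *)
- move=> i; rewrite subr_ge0 HE.
  have [_ [al0 be0] xE val] := solE (inord i.-1).
  rewrite /H -[leRHS]val; apply: weak => //.
  by apply: CS (AC i); rewrite (ordW _ i) ?leq_pred.
- by move=> i; exact: norm2_ge0.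
- by move=> i; have [_ []] := solE i.
- by move=> i; have [_ []] := solE i.
(* Equal masses on the maximizers of all cuts but the last. *)
- pose P : probability (n.-tuple R) R := @dirac_average _ _ R m (fun k => A (inord k)).
  have PP : Pell m.+1 aL aU dbar B ahat P.
    move=> i; rewrite /P /= dirac_averageE lee_fin.
    (* Every [A k] with [k >= i] lies in [C i]; there are [ell - i] of them, giving mass
       [1 - lambda_i]. *)
    apply: (@le_trans _ _ (m.+1%:R^-1 * \sum_(k < m.+1) (i <= k)%N%:R)).
      rewrite sum_geq natrB -1?ltnS // mulrBr mulVf ?gt_eqF // /lam.
      by rewrite [in leRHS]mulrC.
    rewrite ler_wpM2l ?invr_ge0 ?ler0n // ler_sum // => k _; rewrite indicE.
    case: leqP => ik; last exact: ler0n.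
    rewrite mem_set //; apply: CS (AC (inord k)).
    by rewrite inordK // ltnS ltnW.
  have := le_trans (ereal_sup_ubound (ex_intro2 _ _ P PP erefl)) supb.
  rewrite /P (integral_dirac_average m _ f mf) lee_fin; apply: le_trans.
  (* Factoring out [1 / ell] prepares the summation by parts, which turns the dual objective into
     the expectation under [P]. *)
  have E : \sum_(i < m.+2) (lam R i - 1) * (H i.-1 - H i) =
      m.+1%:R^-1 * \sum_(i < m.+2) (i%:R - m.+1%:R) * (H i.-1 - H i).
    rewrite mulr_sumr; apply: eq_bigr => i _; rewrite /lam mulrA; congr (_ * _).
    by rewrite mulrBr mulVf ?gt_eqF // mulrC.
  rewrite E sum_weighted_decrements subrr mul0r addr0 mulrBr mulrA mulVf ?gt_eqF //.
  by rewrite mul1r addrC subrK.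
- move=> i; have [_ _ _ ->] := solE i.
  rewrite -/(f (A i)) -HE.
  (* Telescoping turns the right-hand side into [h_i], so every level constraint is tight. *)
  have -> : \sum_(k < m.+2 | (k <= i)%N) (H k.-1 - H k) = H 0%N - H i.
    by rewrite -(big_ord_widen m.+2 (fun k => H k.-1 - H k) (ltn_ord i)) sum_decrements.
  by rewrite opprB addrC subrK.
- by move=> i j; have [_ _ ->] := solE i.
- by move=> i; exact: lexx.
Qed.
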